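(* Let $d\ge2$, $\mu\ge0$ and $\lambda>0$, let $u_\mu$ be the classical ball moment functional on $\Pi^d$, and let $v$ be the moment functional $\langle v,p\rangle=\langle u_\mu,p\rangle+\lambda\,p(\mathbf{0})$. Then $$\lim_{n\to\infty}K_n(v;\mathbf{0},\mathbf{0})=\frac1\lambda.$$
   Context: $\Pi^d$ is the space of real polynomials in $d$ variables and $\|\cdot\|$ the Euclidean norm on $\mathbb{R}^d$. The classical ball moment functional is $$\langle u_\mu,p\rangle=\omega_\mu\int_{\|\mathbf{x}\|\le1}p(\mathbf{x})\,(1-\|\mathbf{x}\|^2)^{\mu-1/2}\,d\mathbf{x},\qquad \omega_\mu=\frac{\Gamma(\mu+(d+1)/2)}{\pi^{d/2}\,\Gamma(\mu+1/2)},$$ normalized so that $\langle u_\mu,1\rangle=1$; it is positive definite, and so is $v$ for $\lambda>0$. For a positive definite functional $w$ on $\Pi^d$ (i.e. $\langle w,p^2\rangle>0$ for $p\ne0$), $K_n(w;\mathbf{x},\mathbf{y})=\sum_{k}p_k(\mathbf{x})p_k(\mathbf{y})$, where $\{p_k\}$ is any basis of the space of polynomials of total degree at most $n$ that is orthonormal with respect to $(p,q)\mapsto\langle w,pq\rangle$ (the reproducing kernel, independent of the basis). *)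

(* Defs.v *)
From HB Require Import structures.
From mathcomp Require Import all_boot all_order all_algebra.
From mathcomp Require mpoly.
(* Some notations of mpoly clash with those of MathComp-Analysis, which is
   imported last because both define modules called Measure. *)
Import -(notations) mpoly.
From mathcomp Require Import all_classical all_reals all_analysis.

Set Implicit Arguments.
Unset Strict Implicit.
Unset Printing Implicit Defensive.

Import Order.TTheory GRing.Theory Num.Theory.
Import numFieldNormedType.Exports.

Local Open Scope classical_set_scope.
Local Open Scope ring_scope.

Section lebesgue_cons.
Variables (R : realType) (d : nat).
Local Notation RT := (measurableTypeR R).
Variable m : {sigma_finite_measure set (d.-tuple RT) -> \bar R}.

Definition tuple_of_pair (z : RT * d.-tuple RT) : d.+1.-tuple RT :=
  [tuple of z.1 :: z.2].

Let pair_of_tuple (t : d.+1.-tuple RT) : RT * d.-tuple RT :=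
  (thead t, [tuple of behead t]).

Lemma measurable_tuple_of_pair : measurable_fun setT tuple_of_pair.
Proof. exact: measurable_cons. Qed.

Let measurable_pair_of_tuple : measurable_fun setT pair_of_tuple.
Proof.
apply/measurable_fun_pairP; split.
- exact: measurable_tnth.
- exact: measurable_behead.
Qed.

Let tuple_of_pairK : cancel tuple_of_pair pair_of_tuple.
Proof. by move=> [x t]; congr pair; apply: val_inj. Qed.

Definition lebesgue_cons : set (d.+1.-tuple RT) -> \bar R :=
  pushforward (@lebesgue_measure R \x m)%E tuple_of_pair.

HB.instance Definition _ := Measure.copy lebesgue_cons
  (measure_function_pushforward__canonical__measure_function_Measure
    (@lebesgue_measure R \x m)%E measurable_tuple_of_pair).

Let sigma_finite_lebesgue_cons : sigma_finite setT lebesgue_cons.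
Proof.
have /sigma_finiteP[F [FT ndF Foo]] := sigma_finiteT (@lebesgue_measure R).
have /sigma_finiteP[G [GT ndG Goo]] := sigma_finiteT m.
exists (fun k => pair_of_tuple @^-1` (F k `*` G k)).
  rewrite -preimage_bigcup (_ : \bigcup_k _ = setT) ?preimage_setT//.
  rewrite -subTset => -[x y] _.
  have [i _ Fix] : (\bigcup_k F k) x by rewrite -FT.
  have [j _ Gjy] : (\bigcup_k G k) y by rewrite -GT.
  exists (maxn i j) => //; split => /=.
  - by move: x Fix; apply/subsetPset/ndF/leq_maxl.
  - by move: y Gjy; apply/subsetPset/ndG/leq_maxr.
move=> k; have [mF Fk] := Foo k; have [mG Gk] := Goo k; split.
  by rewrite -[X in measurable X]setTI; apply: measurable_pair_of_tuple => //;
    exact: measurableX.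
rewrite /lebesgue_cons /pushforward -comp_preimage.
rewrite (_ : _ \o _ = id); last by rewrite funeqE => z /=; rewrite tuple_of_pairK.
rewrite preimage_id product_measure1E// lte_mul_pinfty//.
by rewrite ge0_fin_numE.
Qed.

HB.instance Definition _ := Measure_isSigmaFinite.Build _ _ _ lebesgue_cons
  sigma_finite_lebesgue_cons.

End lebesgue_cons.

(* Lebesgue measure on R^d, as an iterated product measure. *)
Fixpoint lebesgue_tuple (R : realType) (d : nat) :
    {sigma_finite_measure set (d.-tuple (measurableTypeR R)) -> \bar R} :=
  match d with
  | 0 => \d_ [tuple]
  | d'.+1 => lebesgue_cons (lebesgue_tuple R d')
  end.

Definition euler_gamma (R : realType) (s : R) : R :=
  \int[@lebesgue_measure R]_(t in `]0, +oo[) (t `^ (s - 1) * expR (- t)).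

Section polynomials.
Variables (R : realType) (d : nat).

(* [meval] takes the point as a function ['I_d -> R]. *)
Definition peval (p : mpoly d R) (x : d.-tuple R) : R := meval (tnth x) p.

Definition origin : d.-tuple R := [tuple 0 | _ < d].

Definition enorm (x : d.-tuple R) : R := Num.sqrt (\sum_(i < d) tnth x i ^+ 2).

Definition ball_constant (mu : R) : R :=
  euler_gamma (mu + (d%:R + 1) / 2) / (pi `^ (d%:R / 2) * euler_gamma (mu + 1 / 2)).

Definition ball_moment (mu : R) (p : mpoly d R) : R :=
  ball_constant mu *
  \int[lebesgue_tuple R d]_(x in [set x : d.-tuple R | enorm x <= 1])
    (peval p x * (1 - enorm x ^+ 2) `^ (mu - 1 / 2)).

Definition add_point_mass (u : mpoly d R -> R) (lambda : R) (a : d.-tuple R)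
    (p : mpoly d R) : R := u p + lambda * peval p a.

(* [mmeasure mdeg p] is [msize p]: one plus the total degree, and 0 for p = 0. *)
Definition degree_le (n : nat) (p : mpoly d R) : Prop :=
  (mmeasure mdeg p <= n.+1)%N.

Definition poly_basis (n k : nat) (p : 'I_k -> mpoly d R) : Prop :=
  [/\ forall i, degree_le n (p i),
      forall c : 'I_k -> R, \sum_(i < k) c i *: p i = 0 -> forall i, c i = 0 &
      forall q, degree_le n q -> exists c : 'I_k -> R, q = \sum_(i < k) c i *: p i].

Definition orthonormal_for (w : mpoly d R -> R) (k : nat)
    (p : 'I_k -> mpoly d R) : Prop :=
  forall i j, w (p i * p j) = (i == j)%:R.

(* The value is independent of the choice of the basis; it is 0 if there is no
   orthonormal basis, which cannot happen when w is a positive definite linear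
   functional. *)
Definition reproducing_kernel (w : mpoly d R -> R) (n : nat) (x y : d.-tuple R) : R :=
  xget 0 [set s | exists k (p : 'I_k -> mpoly d R),
    [/\ poly_basis n p, orthonormal_for w p &
        s = \sum_(i < k) peval (p i) x * peval (p i) y]].

End polynomials.

Arguments origin : clear implicits.

(* Main.v *)
(* By the extremal property of the kernel, [1 / K_n(v; 0, 0)] is the minimum of [v (f ^ 2)]
   over the polynomials [f] of degree at most [n] with [f(0) = 1], and
   [v (f ^ 2) = u (f ^ 2) + lambda] for such [f]. Hence [K_n <= 1 / lambda], with equality in
   the limit as soon as [u (f ^ 2)] can be made arbitrarily small: take
   [f = (1 - |x| ^ 2) ^ k], which tends to 0 almost everywhere on the ball.

   Positive definiteness of [u] is needed only for the existence of an orthonormal basis.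
   Integrability of the weight reduces to [mu = 0], where integrating out one variable gives
   the arcsine integral [\int_(-r, r) (r ^ 2 - x ^ 2) ^ (- 1 / 2) = pi]; only its finiteness is
   used, so the bound [pi] for every [r] suffices. *)
Require Import Defs.
From mathcomp Require Import all_boot all_order all_algebra.
From mathcomp Require mpoly.
Import -(notations) mpoly.
From mathcomp Require Import all_classical all_reals all_analysis.
From mathcomp Require Import measurable_realfun zify ring lra.
Import Order.TTheory GRing.Theory Num.Theory.
Import numFieldNormedType.Exports.
Local Open Scope classical_set_scope.
Local Open Scope ring_scope.

Set Implicit Arguments.
Unset Strict Implicit.
Unset Printing Implicit Defensive.

(** * Orthonormal bases and bounds on the reproducing kernel *)

(** Each new [x] is replaced by its remainder [r] after projection onto the span found so far. A
    zero remainder is dropped, so [k] is not tied to [size s]; a nonzero one is normalized, which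
    [w_pos] allows. The predicate [D] carries the degree bound through the induction. *)
Lemma gram_schmidt (R : rcfType) (A : comAlgType R) (w : A -> R)
    (w_lin : forall a p q, w (a *: p + q) = a * w p + w q)
    (w_pos : forall p, p != 0 -> 0 < w (p * p))
    (D : A -> Prop) (D0 : D 0)
    (D_lin : forall a p q, D p -> D q -> D (a *: p + q))
    (s : seq A) (sD : forall x, x \in s -> D x) :
  exists k (p : 'I_k -> A),
    [/\ forall i, D (p i), forall i j, w (p i * p j) = (i == j)%:R &
        forall x, x \in s -> exists c : 'I_k -> R, x = \sum_(i < k) c i *: p i].
Proof.
have w0 : w 0 = 0.
  by have := w_lin (-1) 0 0; rewrite scaleN1r addNr mulN1r addNr.
have wZ a p : w (a *: p) = a * w p by have := w_lin a p 0; rewrite !addr0 w0 addr0.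
have w_sum (I : finType) (c : I -> R) (p : I -> A) :
    w (\sum_i c i *: p i) = \sum_i c i * w (p i).
  by elim/big_rec2: _ => // i x y _ <-; rewrite w_lin.
have D_sum (I : finType) (c : I -> R) (p : I -> A) :
    (forall i, D (p i)) -> D (\sum_i c i *: p i).
  by move=> Dp; elim/big_rec: _ => // i x _; exact: D_lin.
elim: s sD => [_|x s IH sD].
  by exists 0%N, (fun=> 0); split => // -[].
have [|k [p [Dp onp ps]]] := IH.
  by move=> y ys; apply: sD; rewrite inE ys orbT.
pose r := x - \sum_i w (x * p i) *: p i.
have rp j : w (r * p j) = 0.
  rewrite /r mulrBl -scaleN1r addrC w_lin mulN1r mulr_suml.
  under eq_bigr do rewrite -scalerAl.
  rewrite w_sum (bigD1 j)//= onp eqxx mulr1 big1 ?addr0 ?addNr// => i ij.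
  by rewrite onp (negbTE ij) mulr0.
have [r0|r_neq0] := eqVneq r 0.
  exists k, p; split=> // y; rewrite inE => /predU1P[->|/ps//].
  by exists (fun i => w (x * p i)); apply/eqP; rewrite -subr_eq0; apply/eqP.
have rr := w_pos r r_neq0; set m := Num.sqrt (w (r * r)).
have m_gt0 : 0 < m by rewrite sqrtr_gt0.
pose e := m^-1 *: r.
have ep j : w (e * p j) = 0 by rewrite /e -scalerAl wZ rp mulr0.
have ee : w (e * e) = 1.
  rewrite /e -scalerAl -scalerAr !wZ mulrA -invfM -expr2 sqr_sqrtr ?ltW//.
  by rewrite mulVf ?gt_eqF.
pose q (i : 'I_k.+1) := if unlift ord0 i is Some j then p j else e.
have q0 : q ord0 = e by rewrite /q unlift_none.
have qS j : q (lift ord0 j) = p j by rewrite /q liftK.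
exists k.+1, q; split.
- move=> i; case: (unliftP ord0 i) => [j|] ->; rewrite ?q0 ?qS//.
  rewrite /e -[_ *: _]addr0; apply: (D_lin) => //; rewrite /r addrC -scaleN1r.
  by apply: D_lin; [exact: D_sum|apply: sD; rewrite mem_head].
- move=> i j; case: (unliftP ord0 i) => [i'|] ->; case: (unliftP ord0 j) => [j'|] ->;
    rewrite ?q0 ?qS ?eqxx//; last by rewrite mulrC ep.
- move=> y; rewrite inE => /predU1P[->|/ps[c ->]].
  + exists (fun i => if unlift ord0 i is Some j then w (x * p j) else m).
    rewrite big_ord_recl unlift_none q0 /e scalerA divff ?gt_eqF// scale1r.
    under eq_bigr do rewrite liftK qS.
    by rewrite subrK.
  + exists (fun i => if unlift ord0 i is Some j then c j else 0).
    rewrite big_ord_recl unlift_none q0 scale0r add0r.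
    by under [RHS]eq_bigr do rewrite liftK qS.
Qed.

Section reproducing_kernel_bounds.
Variables (R : realType) (d : nat) (w : mpoly d R -> R).
Hypothesis w_lin : forall a p q, w (a *: p + q) = a * w p + w q.

Let w_sum (k : nat) (c : 'I_k -> R) (p : 'I_k -> mpoly d R) :
  w (\sum_i c i *: p i) = \sum_i c i * w (p i).
Proof.
elim/big_rec2: _ => [|i x y _ <-]; last by rewrite w_lin.
by have := w_lin (-1) 0 0; rewrite scaleN1r addNr mulN1r addNr.
Qed.

Lemma orthonormal_dot (k : nat) (p : 'I_k -> mpoly d R) (c : 'I_k -> R) :
  orthonormal_for w p ->
  let q := \sum_i c i *: p i in w (q * q) = \sum_i c i ^+ 2.
Proof.
move=> onp q; rewrite {1}/q mulr_suml.
under eq_bigr do rewrite -scalerAl.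
rewrite w_sum; apply: eq_bigr => i _; rewrite expr2; congr (_ * _).
rewrite /q mulr_sumr.
under eq_bigr do rewrite -scalerAr.
rewrite w_sum (bigD1 i)//= onp eqxx mulr1 big1 ?addr0// => j ji.
by rewrite onp eq_sym (negbTE ji) mulr0.
Qed.

Lemma peval_sum (k : nat) (p : 'I_k -> mpoly d R) (c : 'I_k -> R) (x : d.-tuple R) :
  peval (\sum_i c i *: p i) x = \sum_i c i * peval (p i) x.
Proof.
rewrite /peval (raddf_sum (meval (tnth x))).
by apply: eq_bigr => i _; exact: mevalZ.
Qed.

Hypothesis w_pos : forall p, p != 0 -> 0 < w (p * p).

(** The default value of [xget] is never reached: Gram-Schmidt applied to the monomials of degree at
    most [n] yields an orthonormal basis. *)
Lemma reproducing_kernel_orthonormal (n : nat) (x y : d.-tuple R) :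
  exists k (p : 'I_k -> mpoly d R), [/\ poly_basis n p, orthonormal_for w p &
    reproducing_kernel w n x y = \sum_(i < k) peval (p i) x * peval (p i) y].
Proof.
rewrite /reproducing_kernel; set S := [set s | _].
have : S (xget 0 S); last by move=> [k [p ?]]; exists k, p.
apply: xgetPex.
have D_lin (a : R) (p q : mpoly d R) :
    degree_le n p -> degree_le n q -> degree_le n (a *: p + q).
  move=> hp hq; apply: (leq_trans (mmeasureD_le _ _ _)).
  by rewrite geq_max hq (leq_trans (mmeasureZ_le _ _ _)).
(* The index of [bmultinom] bounds the degree strictly, hence [n.+1]. *)
pose s := [seq mpolyX R (bmnm m) | m <- enum {: bmultinom d n.+1}].
have [||k [p [Dp onp ps]]] := gram_schmidt w_lin w_pos (D := @degree_le R d n) _ D_lin (s := s).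
- by rewrite /degree_le mmeasure0.
- by move=> _ /mapP[m _ ->]; rewrite /degree_le mmeasureX; exact: bmdeg.
exists (\sum_i peval (p i) x * peval (p i) y), k, p; split => //; split => //.
(* Linear independence: by orthonormality the squares of the coefficients add up to [w 0 = 0]. *)
- move=> c c0 i; have := orthonormal_dot c onp.
  rewrite /= c0 mul0r.
  have -> : w 0 = 0 by have := w_lin (-1) 0 0; rewrite scaleN1r addNr mulN1r addNr.
  move=> /esym /eqP; rewrite psumr_eq0; last by move=> *; exact: sqr_ge0.
  by move=> /allP /(_ i (mem_index_enum _)); rewrite sqrf_eq0 => /eqP.
- move=> q hq; rewrite (mpolywE hq).
  elim/big_rec: _ => [|m q' _ [c' ->]].
    by exists (fun=> 0); rewrite big1// => i _; rewrite scale0r.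
  have [|c ->] := ps (mpolyX R (bmnm m)); first by apply: map_f; rewrite mem_enum.
  exists (fun i => mcoeff (bmnm m) q * c i + c' i).
  rewrite scaler_sumr -big_split; apply: eq_bigr => i _.
  by rewrite scalerDl scalerA.
Qed.

(** The hypothesis is applied to the polynomial [q = K_n(x, .)]. Both [q(x)] and [w (q * q)] equal
    [K = K_n(x, x)], so [lambda * K ^+ 2 <= K]. *)
Lemma reproducing_kernel_le (lambda : R) (n : nat) (x : d.-tuple R) : 0 < lambda ->
  (forall p, lambda * peval p x ^+ 2 <= w (p * p)) ->
  reproducing_kernel w n x x <= 1 / lambda.
Proof.
move=> l0 wl; have [k [p [_ onp ->]]] := reproducing_kernel_orthonormal n x x.
have := wl (\sum_i peval (p i) x *: p i).
rewrite orthonormal_dot// peval_sum; under [X in _ <= X]eq_bigr do rewrite expr2.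
have : 0 <= \sum_(i < k) peval (p i) x * peval (p i) x.
  by apply: sumr_ge0 => i _; rewrite -expr2 sqr_ge0.
set K := \sum_i _; rewrite le_eqVlt => /predU1P[<- _|K0]; first by rewrite ler_pdivlMr// mul0r.
by rewrite expr2 mulrA -[X in _ <= X -> _]mul1r ler_pM2r// => ?; rewrite ler_pdivlMr// mulrC.
Qed.

(** This is Cauchy-Schwarz for the coefficients of [f] in the orthonormal basis and the values of
    the basis at [x], whose dot product is [f(x) = 1]. *)
Lemma reproducing_kernel_ge (n : nat) (x : d.-tuple R) (f : mpoly d R) :
  degree_le n f -> peval f x = 1 ->
  1 <= w (f * f) * reproducing_kernel w n x x.
Proof.
have [k [p [[_ _ pn] onp ->]]] := reproducing_kernel_orthonormal n x x.
move=> /pn[c ->]; rewrite peval_sum orthonormal_dot// => h.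
under [X in _ * X]eq_bigr do rewrite -expr2.
set a := \sum_i _; set b := \sum_i _.
have ha : 0 <= a by apply: sumr_ge0 => i _; exact: sqr_ge0.
have quad t : 0 <= a - 2 * t + t ^+ 2 * b.
  have : 0 <= \sum_i (c i - t * peval (p i) x) ^+ 2.
    by apply: sumr_ge0 => i _; exact: sqr_ge0.
  suff -> : \sum_i (c i - t * peval (p i) x) ^+ 2 = a - 2 * t + t ^+ 2 * b by [].
  have -> : 2 * t = \sum_i 2 * t * (c i * peval (p i) x) by rewrite -mulr_sumr h mulr1.
  rewrite /a /b mulr_sumr -sumrN -!big_split/=.
  by apply: eq_bigr => i _; ring.
have hb : 0 <= b by apply: sumr_ge0 => i _; exact: sqr_ge0.
(* For [a > 0], the choice [t = a] gives [a * (a * b - 1) >= 0]. *)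
move: ha; rewrite le_eqVlt => /predU1P[a0|a0]; last by have := quad a; nra.
(* The case [a = 0] is impossible, since the quadratic is negative at this [t]; [b + 1] stays
   nonzero even if [b = 0]. *)
have := quad (b + 1)^-1; rewrite -a0 add0r.
have -> : - (2 * (b + 1)^-1) + (b + 1)^-1 ^+ 2 * b = - ((b + 2) / (b + 1) ^+ 2).
  by field; rewrite gt_eqF// ltr_wpDl.
by rewrite oppr_ge0 leNgt divr_gt0// ?exprn_gt0// ltr_wpDl.
Qed.

End reproducing_kernel_bounds.

(** * Nonvanishing, continuity and measurability of polynomials *)

(** Reduction modulo [N] recovers the lowest digit, and cancelling [N] leaves the shifted
    expansions. The digits are functions on [nat], so that the induction can shift them by
    composition with [S]. *)
Lemma base_expansion_inj (N d : nat) (a b : nat -> nat) :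
  (forall i, (i < d)%N -> (a i < N)%N) -> (forall i, (i < d)%N -> (b i < N)%N) ->
  (\sum_(i < d) a i * N ^ i = \sum_(i < d) b i * N ^ i)%N ->
  forall i, (i < d)%N -> a i = b i.
Proof.
elim: d a b => // d IH a b aN bN.
have shift (c : nat -> nat) :
    (\sum_(i < d.+1) c i * N ^ i = c 0 + (\sum_(i < d) c i.+1 * N ^ i) * N)%N.
  rewrite big_ord_recl expn0 muln1 big_distrl; congr (_ + _)%N.
  by apply: eq_bigr => i _; rewrite /= expnSr mulnA.
rewrite !shift => ab.
have N0 : (0 < N)%N by rewrite (leq_trans _ (aN 0 _)).
have ab0 : a 0 = b 0.
  have := congr1 (fun n => n %% N)%N ab.
  by rewrite addnC modnMDl [in RHS]addnC modnMDl !modn_small ?aN ?bN.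
move: ab; rewrite ab0 => /addnI /eqP; rewrite eqn_pmul2r// => /eqP ab [|i] id //.
apply: (IH (a \o S) (b \o S)) => //= j jd; [exact: aN|exact: bN].
Qed.

(** The [size P] distinct candidates [delta / k.+1%:R] outnumber the roots of [P]. *)
Lemma exists_nonroot (R : realFieldType) (P : {poly R}) (delta : R) :
  P != 0 -> 0 < delta -> exists t, [/\ 0 < t, t <= delta & ~~ root P t].
Proof.
move=> P0 d0; pose s := [seq delta / k.+1%:R | k <- iota 0 (size P)].
have s_uniq : uniq s.
  rewrite map_inj_uniq ?iota_uniq// => i j /(mulfI (lt0r_neq0 d0))/invr_inj/eqP.
  by rewrite eqr_nat => /eqP[].
have : ~~ all (root P) s.
  apply/negP => hs; have := max_poly_roots P0 hs s_uniq.
  by rewrite size_map size_iota ltnn.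
move=> /allPn[_ /mapP[k _ ->] nr]; exists (delta / k.+1%:R); split => //.
- by rewrite divr_gt0.
- by rewrite ler_pdivrMr// ler_peMr ?ler1n ?ltW.
Qed.

(* Kronecker's substitution [x_i = t ^ (N ^ i)], with [N] larger than all exponents,
   turns distinct monomials into distinct powers of [t]. *)
Lemma peval_neq0_near0 (R : realType) (d : nat) (p : mpoly d R) (delta : R) :
  p != 0 -> 0 < delta ->
  exists2 x : d.-tuple R, forall i, `|tnth x i| <= delta & peval p x != 0.
Proof.
move=> p0 d0; pose N := mmeasure mdeg p.
have N0 : (0 < N)%N by rewrite lt0n mmeasure_poly_eq0.
have mN m (i : 'I_d) : m \in msupp p -> (m i < N)%N.
  move=> /(mmeasure_mnm_lt mdeg); apply: leq_ltn_trans.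
  by rewrite -[leqRHS]/(mdeg m) mdegE (bigD1 i)//= leq_addr.
pose K (m : multinom d) := (\sum_(i < d) m i * N ^ i)%N.
have K_inj : {in msupp p &, injective K}.
  move=> m m' mp m'p KK; apply/mnmP => i.
  pose a (m : multinom d) (j : nat) : nat := if insub j is Some j' then m j' else 0%N.
  have aE (m'' : multinom d) (j : 'I_d) : a m'' j = m'' j by rewrite /a valK.
  rewrite -!aE; apply: (@base_expansion_inj N d) => //.
  - by move=> j jd; rewrite /a insubT mN.
  - by move=> j jd; rewrite /a insubT mN.
  - by under eq_bigr do rewrite aE; under [RHS]eq_bigr do rewrite aE.
pose P : {poly R} := \sum_(m <- msupp p) mcoeff m p *: 'X^(K m).
have P0 : P != 0.
  have [m mp] : exists m, m \in msupp p.
    case E : (msupp p) => [|m s]; last by exists m; rewrite mem_head.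
    by move: p0; rewrite -msupp_eq0 E.
  apply/eqP => /(congr1 (fun q : {poly R} => q`_(K m))).
  rewrite coef_sum (bigD1_seq m) ?msupp_uniq//= coefZ coefXn eqxx mulr1 coef0.
  rewrite big_seq_cond big1 ?addr0.
    by apply/eqP; rewrite -mcoeff_msupp.
  move=> m' /andP[m'p m'm]; rewrite coefZ coefXn.
  by rewrite (inj_in_eq K_inj)// eq_sym (negbTE m'm) mulr0.
(* With [t <= 1], every coordinate [t ^+ (N ^ i)] is at most [t], hence at most [delta]. *)
have d1 : 0 < Num.min delta 1 by rewrite lt_min d0 ltr01.
have [t [t0 td nr]] := exists_nonroot P0 d1.
move: td; rewrite le_min => /andP[td t1].
exists [tuple t ^+ (N ^ i) | i < d].
  move=> i; rewrite tnth_mktuple normrX gtr0_norm// (le_trans _ td)//.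
  have : (0 < N ^ i)%N by rewrite expn_gt0 N0.
  by case: (N ^ i)%N => // n _; rewrite exprS ler_piMr ?exprn_ile1// ltW.
move: nr; rewrite /root /P horner_sum /peval mevalE.
congr (_ != 0); apply: eq_bigr => m _; rewrite hornerZ hornerXn; congr (_ * _).
rewrite /K -prodrXr; apply: eq_bigr => i _.
by rewrite tnth_mktuple -exprM mulnC.
Qed.

(** Points are row vectors here because these carry the sup-norm topology; [peval_near] brings the
    result back to tuples. *)
Lemma continuous_meval (R : realType) (d : nat) (p : mpoly d R) :
  continuous (fun u : 'rV[R]_d => meval (u ord0) p).
Proof.
elim/mpolyind: p => [|c m p _ _ IH].
  rewrite (_ : (fun _ => _) = cst 0); first exact: cst_continuous.
  by apply/funext => u; rewrite meval0.
rewrite (_ : (fun _ => _) =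
    fun u : 'rV[R]_d => c * \prod_i u ord0 i ^+ m i + meval (u ord0) p); last first.
  by apply/funext => u; rewrite mevalD mevalZ mevalX.
have cont_prod (s : seq 'I_d) : continuous (fun u : 'rV[R]_d => \prod_(i <- s) u ord0 i ^+ m i).
  elim: s => [|i s IHs].
    rewrite (_ : (fun _ => _) = cst 1); first exact: cst_continuous.
    by apply/funext => v; rewrite big_nil.
  rewrite (_ : (fun _ => _) =
      (fun v : 'rV[R]_d => v ord0 i ^+ m i) \* (fun v => \prod_(j <- s) v ord0 j ^+ m j)).
    move=> u; apply: continuousM; last exact: IHs.
    apply: (@continuous_comp _ _ _ (fun v : 'rV[R]_d => v ord0 i) (fun t : R => t ^+ m i)).
      exact: coord_continuous.
    exact: exprn_continuous.
  by apply/funext => v; rewrite big_cons.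
move=> u; apply: (@continuousD _ _ _ (fun v : 'rV[R]_d => c * _) (fun v => meval (v ord0) p)).
  apply: (@continuousM _ _ (fun _ => c) (fun v : 'rV[R]_d => \prod_(i < d) v ord0 i ^+ m i)).
    exact: cst_continuous.
  exact: cont_prod.
exact: IH.
Qed.

Lemma peval_near (R : realType) (d : nat) (p : mpoly d R) (x : d.-tuple R) (e : R) :
  0 < e -> exists2 delta : R, 0 < delta &
    forall y : d.-tuple R, (forall i, `|tnth y i - tnth x i| <= delta) ->
      `|peval p y - peval p x| < e.
Proof.
move=> e0.
have := @continuous_meval R d p (\row_i tnth x i).
move=> /cvgrPdist_lt /(_ e e0) /nbhs_ballP[delta/= delta0 h].
(* Halving turns the non-strict bound on the coordinates into the strict one of the open ball. *)
exists (delta / 2); first by rewrite divr_gt0.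
move=> y yx; have := h (\row_i tnth y i).
rewrite distrC /peval.
have rowE (z : d.-tuple R) : meval ((\row_i tnth z i) ord0) p = meval (tnth z) p.
  by apply: meval_eq => i; rewrite mxE.
rewrite !rowE; apply; split => // i j.
rewrite !mxE /ball/= distrC (le_lt_trans (yx j))//.
by rewrite ltr_pdivrMr// ltr_pMr// ltr1n.
Qed.

Lemma measurable_peval (R : realType) (d : nat) (p : mpoly d R) :
  measurable_fun [set: d.-tuple (measurableTypeR R)] (peval p).
Proof.
rewrite (_ : peval p = fun x : d.-tuple (measurableTypeR R) =>
  \sum_(m <- msupp p) mcoeff m p * \prod_(i < d) tnth x i ^+ m i); last first.
  by apply/funext => x; rewrite /peval mevalE.
apply: measurable_sum => m; apply: measurable_funM => //.
apply: measurable_prod => i _; apply: measurable_funX.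
exact: measurable_tnth.
Qed.

(** * Improper integrals in one variable *)

(** The fundamental theorem of calculus gives [F (B n) - F (A n) <= 2 * M] on each compact interval,
    and monotone convergence passes to the union. A bound on [F] thus replaces its limits at the
    endpoints. *)
Lemma ge0_integral_antiderivative_le (R : realType) (f F : R -> R) (A B : nat -> R) (M : R) :
  (forall n, A n < B n) ->
  {homo A : n m / (n <= m)%N >-> m <= n} -> {homo B : n m / (n <= m)%N >-> n <= m} ->
  (forall n x, A n <= x <= B n -> [/\ 0 <= f x, is_derive x 1 F (f x),
    {for x, continuous f} & `|F x| <= M]) ->
  (\int[@lebesgue_measure R]_(x in \bigcup_n `[A n, B n]%classic) (f x)%:E <= (2 * M)%:E)%E.
Proof.
move=> AB hA hB h.
have inE' n x : x \in `[A n, B n] -> A n <= x <= B n by rewrite in_itv.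
have cf n : {within `[A n, B n]%classic, continuous f}.
  by apply: continuous_in_subspaceT => x; rewrite inE /= => /inE'/h[].
have f_ge0 n x : `[A n, B n]%classic x -> (0 <= (f x)%:E)%E.
  by rewrite /= => /inE'/h[f0 _ _ _]; rewrite lee_fin.
have mf n : measurable_fun `[A n, B n]%classic (EFin \o f).
  by apply/measurable_EFinP; exact: subspace_continuous_measurable_fun.
have nd : nondecreasing_seq (fun n => `[A n, B n]%classic).
  move=> n m nm; apply/subsetPset => x /=; rewrite !in_itv/= => /andP[Ax xB].
  by rewrite (le_trans (hA _ _ nm))// (le_trans xB)// hB.
have mE n : measurable `[A n, B n]%classic by exact: measurable_itv.
rewrite -(cvg_lim _ (ge0_nondecreasing_set_cvg_integral
  (mu := @lebesgue_measure R) nd mE mf f_ge0))//.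
have dF n x : x \in `[A n, B n] -> is_derive x 1 F (f x) by move=> /inE'/h[].
have cF n x : x \in `[A n, B n] -> {for x, continuous F}.
  move=> /dF Fx; apply/differentiable_continuous; exact/derivable1_diffP.
apply: lime_le.
  apply: ereal_nondecreasing_is_cvgn.
  exact: (@ge0_nondecreasing_set_nondecreasing_integral _ _ _ _ _ lebesgue_measure nd mE mf f_ge0).
apply: nearW => n; rewrite /= (@continuous_FTC2 _ f F)//.
- rewrite -EFinB lee_fin.
  have [|_ _ _ +] := h n (A n); first by rewrite lexx ltW.
  have [|_ _ _ +] := h n (B n); first by rewrite lexx ltW.
  by rewrite !ler_norml; lra.
- split.
  + by move=> x /subset_itv_oo_cc /dF.
  + apply: cvg_at_right_filter; apply: (cF n); rewrite in_itv/= lexx ltW//.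
  + apply: cvg_at_left_filter; apply: (cF n); rewrite in_itv/= lexx ltW//.
- move=> x /subset_itv_oo_cc /dF Fx; rewrite derive1E; exact: derive_val.
Qed.

(** An antiderivative is [asin (x / r)], bounded by [pi / 2]. The open interval is exhausted from
    inside because the integrand blows up at both ends. *)
Lemma integral_arcsine_le (R : realType) (r : R) : 0 < r ->
  (\int[@lebesgue_measure R]_(x in `](- r)%R, r[%classic)
    ((Num.sqrt (r ^+ 2 - x ^+ 2))^-1)%:E <= pi%:E)%E.
Proof.
(* The shift [n.+2] makes [B 0 = r / 2] positive, so that no interval is degenerate. *)
move=> r0; pose B (n : nat) : R := r * (1 - n.+2%:R^-1).
have B0 n : 0 < B n.
  by rewrite mulr_gt0// subr_gt0 invf_lt1// ltr1n.
have Br n : B n < r by rewrite gtr_pMr// ltrBlDr ltrDl invr_gt0.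
have hB : {homo B : n m / (n <= m)%N >-> n <= m}.
  by move=> n m nm; rewrite ler_pM2l// lerB// lef_pV2 ?posrE// ler_nat.
have -> : `]-r, r[%classic = \bigcup_n `[- B n, B n]%classic.
  apply/seteqP; split => x /=.
    rewrite in_itv/= -ltr_norml => xr.
    have /ltr_add_invr[k] : `|x| / r < 1 by rewrite ltr_pdivrMr// mul1r.
    rewrite -ltrBrDr ltr_pdivrMr// mulrC => xk.
    exists k => //=; rewrite in_itv/= -ler_norml (le_trans (ltW xk))// ler_pM2l// lerB//.
    by rewrite lef_pV2 ?posrE// ler_nat.
  by move=> [n _ /=]; rewrite !in_itv/= -ler_norml -ltr_norml => /le_lt_trans; exact.
rewrite [leRHS](_ : _ = (2 * (pi / 2))%:E); last by congr EFin; field.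
apply: (@ge0_integral_antiderivative_le _ _ (fun x => asin (x / r))) => //.
- by move=> n; rewrite gtrN.
- by move=> n m nm; rewrite lerN2 hB.
move=> n x; rewrite -ler_norml => /le_lt_trans /(_ (Br n)) xr.
have x1 : -1 < x / r < 1.
  by rewrite -ltr_norml normrM normfV (gtr0_norm r0) ltr_pdivrMr// mul1r.
have rx : 0 < r ^+ 2 - x ^+ 2.
  by rewrite subr_gt0 -[ltLHS]real_normK ?num_real// ltr_sqr ?nnegrE// ltW.
split.
- by rewrite invr_ge0 sqrtr_ge0.
- have h1 : is_derive x 1 (fun x => x / r) r^-1.
    by apply: is_derive_eq; rewrite scaler0 add0r; apply: mulr1.
  have h2 := is_derive1_asin x1.
  have h3 := @is_derive1_comp _ asin (fun x => x / r) x _ _ h2 h1.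
  apply: (is_derive_eq h3).
  have -> : r ^+ 2 - x ^+ 2 = r ^+ 2 * (1 - (x / r) ^+ 2) by field; rewrite gt_eqF.
  by rewrite sqrtrM ?sqr_ge0// sqrtr_sqr gtr0_norm// invfM mulrC.
- have c1 : {for x, continuous (fun y : R => r ^+ 2 - y ^+ 2)}.
    by apply: cvgB; [exact: cvg_cst|exact: exprn_continuous].
  have c2 := continuous_comp c1 (@sqrt_continuous R (r ^+ 2 - x ^+ 2)).
  by apply: (continuousV _ c2); rewrite /= gt_eqF// sqrtr_gt0.
- rewrite ler_norml asin_geNpi2 ?asin_lepi2//; move: x1 => /andP[? ?]; rewrite !ltW//.
Qed.

(** An antiderivative is [2 * atan (Num.sqrt x)], bounded by [pi]. The integrand serves, up to a
    constant, as a majorant of the Gamma integrand both near 0 and at infinity. *)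
Lemma integral_sqrt_inv_le (R : realType) :
  (\int[@lebesgue_measure R]_(x in `]0%R, +oo[%classic)
    ((Num.sqrt x)^-1 / (1 + x))%:E <= (2 * pi)%:E)%E.
Proof.
pose A (n : nat) : R := n.+1%:R^-1.
have A0 n : 0 < A n by rewrite invr_gt0.
have -> : `]0, +oo[%classic = \bigcup_n `[A n, n.+2%:R]%classic.
  apply/seteqP; split => x /=.
    rewrite in_itv/= andbT => x0.
    have [k] := ltr_add_invr x0; rewrite add0r => kx.
    have [m xm] : exists m : nat, x <= m%:R.
      by exists (Num.bound x); apply/ltW/archi_boundP/ltW.
    exists (maxn k m) => //=; rewrite in_itv/= (le_trans _ (ltW kx))//=; last first.
      by rewrite lef_pV2 ?posrE// ler_nat ltnS leq_maxl.
    by rewrite (le_trans xm)// ler_nat -addn2 (leq_trans (leq_maxr k m))// leq_addr.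
  by move=> [n _ /=]; rewrite !in_itv/= andbT => /andP[+ _]; exact: lt_le_trans.
apply: (@ge0_integral_antiderivative_le _ _ (fun x => 2 * atan (Num.sqrt x))).
- move=> n; apply: (@le_lt_trans _ _ 1); last by rewrite ltr1n.
  by rewrite invf_le1// ler1n.
- by move=> n m nm; rewrite lef_pV2 ?posrE// ler_nat.
- by move=> n m nm; rewrite ler_nat.
move=> n x /andP[/(lt_le_trans (A0 n)) x0 _]; have sx : 0 < Num.sqrt x by rewrite sqrtr_gt0.
have x1 : 0 < 1 + x by rewrite addr_gt0.
split.
- by apply/ltW/divr_gt0; rewrite ?invr_gt0.
- have h1 := is_derive1_sqrt x0.
  have h2 := is_derive1_atan (Num.sqrt x).
  have h3 := @is_derive1_comp _ atan Num.sqrt x _ _ h2 h1.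
  apply: is_derive_eq; rewrite sqr_sqrtr ?ltW// /GRing.scale/=.
  by field; rewrite !gt_eqF.
- apply: cvgM.
    by apply: (continuousV _ (@sqrt_continuous R x)); rewrite gt_eqF.
  have c1 : {for x, continuous (fun y : R => 1 + y)}.
    by apply: cvgD; [exact: cvg_cst|exact: cvg_id].
  by apply: (continuousV _ c1); rewrite gt_eqF.
- rewrite normrM ger0_norm// -ler_pdivlMl// ler_norml mulrC.
  by rewrite !ltW ?atan_ltpi2 ?atan_gtNpi2.
Qed.

(** * Positivity of integrals and of the Gamma function *)

(** If the integral were 0, then [f] would vanish almost everywhere on [D], and [A] would lie in a
    null set. *)
Lemma ge0_integral_gt0 d (T : measurableType d) (R : realType)
    (mu : {measure set T -> \bar R}) (D A : set T) (f : T -> \bar R) :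
  measurable D -> measurable_fun D f -> (forall x, D x -> 0 <= f x)%E ->
  measurable A -> A `<=` D -> (forall x, A x -> 0 < f x)%E -> (0 < mu A)%E ->
  (0 < \int[mu]_(x in D) f x)%E.
Proof.
move=> mD mf f0 mA AD fA muA; rewrite lt_neqAle integral_ge0// andbT.
apply/eqP => int0; have : (\int[mu]_(x in D) `|f x| = 0)%E.
  by rewrite [RHS]int0; apply: eq_integral => x; rewrite inE => /f0/gee0_abs.
move=> /(ae_eq_integral_abs mu mD mf)[N [mN muN fN]].
have : (mu A <= mu N)%E.
  apply: le_measure; rewrite ?inE// => x Ax; apply: fN => /(_ (AD _ Ax)) fx0.
  by have := fA _ Ax; rewrite fx0 ltxx.
by rewrite muN leNgt muA.
Qed.

Section euler_gamma_positive.
Variables (R : realType) (s : R).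
Hypothesis s_ge : 1 / 2 <= s.

Let integrand (t : R) : R := t `^ (s - 1) * expR (- t).

Let gamma_bound : exists C : R, forall t, 0 < t ->
  integrand t <= C * ((Num.sqrt t)^-1 / (1 + t)).
Proof.
have [N sN] : exists N : nat, s - 1 / 2 <= N%:R.
  by exists (Num.bound (s - 1 / 2)); apply/ltW/archi_boundP; rewrite subr_ge0.
exists (N.+1`!%:R * expR 1) => t t0; rewrite /integrand.
have t1 : 0 < 1 + t by rewrite addr_gt0.
have -> : s - 1 = (s - 1 / 2) + - 2^-1 by field.
rewrite powRD; last by rewrite (gt_eqF t0) implybT.
rewrite powRN (powR12_sqrt (ltW t0)) -mulrA mulrCA [leRHS]mulrCA.
apply: ler_wpM2l; first by rewrite invr_ge0 sqrtr_ge0.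
rewrite ler_pdivlMr//.
have h1 : t `^ (s - 1 / 2) * (1 + t) <= (1 + t) ^+ N.+1.
  rewrite exprSr ler_wpM2r ?(ltW t1)// -(powR_mulrn _ (ltW t1)).
  apply: (@le_trans _ _ ((1 + t) `^ (s - 1 / 2))).
    by apply: ge0_ler_powR; rewrite ?nnegrE ?subr_ge0 ?(ltW t0) ?(ltW t1)// lerDr.
  by apply: ler_powR => //; rewrite lerDl ltW.
have h2 : (1 + t) ^+ N.+1 <= N.+1`!%:R * (expR 1 * expR t).
  rewrite -expRD mulrC -ler_pdivrMr ?ltr0n ?fact_gt0//.
  by apply: (le_trans _ (expR_ge1Dxn N (ltW t1))); rewrite lerDr.
rewrite mulrAC expRN ler_pdivrMr ?expR_gt0//.
by rewrite -mulrA; exact: le_trans h2.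
Qed.

(** The real-valued integral is 0 when the extended one is infinite, so finiteness has to be shown
    along with positivity. The former comes from [gamma_bound], the latter from the interval
    [[1, 2]]. *)
Lemma euler_gamma_gt0 : 0 < euler_gamma s.
Proof.
pose D : set (measurableTypeR R) := `]0%R, +oo[%classic.
have mD : measurable D by exact: measurable_itv.
have mf : measurable_fun D (EFin \o integrand).
  apply/measurable_EFinP/measurable_funM.
    by apply: measurable_funTS; exact: measurable_powR.
  apply: measurable_funTS; apply: measurableT_comp; first exact: measurable_expR.
  exact: oppr_measurable.
have mg : measurable_fun D (fun t => ((Num.sqrt t)^-1 / (1 + t))%:E).
  apply/measurable_EFinP.
  apply: (eq_measurable_fun (fun t : R => t `^ (- 2^-1) * (1 + t) `^ (- 1))).
    move=> t; rewrite inE /D/= in_itv/= andbT => t0.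
    by rewrite powRN powR12_sqrt ?powR_inv1// ?ltW// addr_gt0.
  apply: measurable_funTS; apply: measurable_funM; first exact: measurable_powR.
  apply: (measurableT_comp (measurable_powR _)).
  exact: measurable_funD.
have g_ge0 t : D t -> (0 <= ((Num.sqrt t)^-1 / (1 + t))%:E)%E.
  rewrite /D/= in_itv/= andbT => t0; rewrite lee_fin.
  by rewrite mulr_ge0 ?invr_ge0 ?sqrtr_ge0// addr_ge0// ltW.
have f_ge0 t : D t -> (0 <= (integrand t)%:E)%E.
  by move=> _; rewrite lee_fin mulr_ge0 ?powR_ge0 ?expR_ge0.
have fin : (\int[@lebesgue_measure R]_(t in D) (integrand t)%:E < +oo)%E.
  have [C hC] := gamma_bound.
  have C0 : 0 <= C.
    have := hC 1 ltr01; rewrite sqrtr1 invr1 mul1r => h.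
    rewrite -(@pmulr_lge0 _ (1 + 1)^-1) ?invr_gt0// (le_trans _ h)//.
    by rewrite mulr_ge0 ?powR_ge0 ?expR_ge0.
  apply: (@le_lt_trans _ _ (\int[@lebesgue_measure R]_(t in D)
      (C%:E * ((Num.sqrt t)^-1 / (1 + t))%:E))%E).
    apply: ge0_le_integral => //.
    - exact: measurable_funeM.
    - by move=> t; rewrite /D/= in_itv/= andbT => t0; rewrite -EFinM lee_fin hC.
  rewrite ge0_integralZl// ?lee_fin//.
  rewrite lte_mul_pinfty//.
  by apply: le_lt_trans (integral_sqrt_inv_le R) _; rewrite ltry.
apply: fine_gt0; rewrite fin andbT.
apply: (@ge0_integral_gt0 _ _ _ lebesgue_measure D `[1%R, 2%R]%classic (EFin \o integrand)) => //.
- by move=> t; rewrite /D/= !in_itv/= andbT => /andP[+ _]; apply: lt_le_trans.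
- move=> t /=; rewrite in_itv/= => /andP[t1 _].
  by rewrite lte_fin mulr_gt0 ?expR_gt0// powR_gt0// (lt_le_trans _ t1).
- rewrite [ltRHS](lebesgue_measure_itv `[1%R, 2%R])/= lte_fin ltr1n -EFinB lte_fin subr_gt0.
  by rewrite ltr1n.
Qed.
End euler_gamma_positive.

(** * Cubes, iterated integrals and the unit ball for the Lebesgue measure on tuples *)

Lemma measurable_cube (R : realType) (d : nat) (c : d.-tuple R) (delta : R) :
  measurable [set y : d.-tuple (measurableTypeR R) |
    forall i, `|tnth y i - tnth c i| <= delta].
Proof.
rewrite (_ : [set _ | _] = \bigcap_(i in [set: 'I_d])
    (@tnth d (measurableTypeR R) ^~ i) @^-1` `[tnth c i - delta, tnth c i + delta]%classic).
  apply: fin_bigcap_measurable => [|i _]; first exact: finite_finset.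
  rewrite -[X in measurable X]setTI; exact: measurable_tnth.
apply/seteqP; split=> y /= h i; [move=> _ /=; have := h i|have /= := h i I];
  by rewrite in_itv/= -ler_distlC distrC.
Qed.

(** Cubes are products, so their volume follows by induction on [d]. They bound the volume of the
    ball, provide sets of positive measure and, for [delta = 0], show that a point is null in
    positive dimension. *)
Lemma lebesgue_tuple_cube (R : realType) (d : nat) (c : d.-tuple R) (delta : R) :
  0 <= delta ->
  lebesgue_tuple R d [set y | forall i, `|tnth y i - tnth c i| <= delta] =
    ((2 * delta) ^+ d)%:E.
Proof.
move=> delta0; elim: d c => [|d IH] c.
  rewrite (_ : [set _ | _] = setT) ?expr0; last first.
    by apply/seteqP; split => // y _ [].
  by rewrite /= diracT.
rewrite /= /lebesgue_cons /pushforward.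
have -> : @tuple_of_pair R d @^-1` [set y | forall i, `|tnth y i - tnth c i| <= delta] =
    `[thead c - delta, thead c + delta]%classic `*`
      [set y | forall i, `|tnth y i - tnth [tuple of behead c] i| <= delta].
  apply/seteqP; split => -[x y] /=.
    move=> h; split.
      by have := h ord0; rewrite /= tnth0 in_itv/= -ler_distlC distrC.
    move=> i; have := h (lift ord0 i); rewrite /= tnthS.
    by rewrite [in X in _ - X](tuple_eta c) tnthS.
  move=> [xc yc] i; case: (unliftP ord0 i) => [j|] ->.
    by rewrite /= tnthS (tuple_eta c) tnthS.
  by rewrite /= tnth0; move: xc; rewrite in_itv/= -ler_distlC distrC.
rewrite product_measure1E//; last first.
  exact: measurable_cube.
rewrite IH [X in (X * _)%E](lebesgue_measure_itv `[_, _])/= lte_fin.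
(* The second case is [delta = 0], where the interval is a single point. *)
case: ifPn => h.
  by rewrite -EFinD -EFinM exprS; congr (_ * _)%:E; ring.
rewrite mul0e; congr EFin.
have -> : delta = 0 by move: h; rewrite -leNgt; lra.
by rewrite mulr0 exprS mul0r.
Qed.

Lemma ge0_integral_lebesgue_tuple (R : realType) (d : nat)
    (f : d.+1.-tuple (measurableTypeR R) -> \bar R) :
  measurable_fun setT f -> (forall x, 0 <= f x)%E ->
  (\int[lebesgue_tuple R d.+1]_x f x =
   \int[lebesgue_tuple R d]_y \int[@lebesgue_measure R]_x f (tuple_of_pair (x, y)))%E.
Proof.
move=> mf f0.
rewrite /= /lebesgue_cons ge0_integral_pushforward//; last exact: measurable_tuple_of_pair.
rewrite preimage_setT (fubini_tonelli2 (f \o @tuple_of_pair R d))//.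
  by apply: measurableT_comp => //; exact: measurable_tuple_of_pair.
by move=> z; exact: f0.
Qed.

Lemma enorm_sqr (R : realType) (d : nat) (x : d.-tuple R) :
  enorm x ^+ 2 = \sum_(i < d) tnth x i ^+ 2.
Proof. by rewrite sqr_sqrtr// sumr_ge0// => i _; exact: sqr_ge0. Qed.

Lemma enorm_le1 (R : realType) (d : nat) (x : d.-tuple R) :
  (enorm x <= 1) = (\sum_(i < d) tnth x i ^+ 2 <= 1).
Proof. by rewrite -enorm_sqr expr_le1// sqrtr_ge0. Qed.

Lemma tnth_le_enorm (R : realType) (d : nat) (x : d.-tuple R) (i : 'I_d) :
  `|tnth x i| <= enorm x.
Proof.
rewrite -sqrtr_sqr ler_sqrt ?sumr_ge0// => [|j _]; last exact: sqr_ge0.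
by rewrite (bigD1 i)//= lerDl sumr_ge0// => j _; exact: sqr_ge0.
Qed.

Lemma measurable_sum_sqr (R : realType) (d : nat) :
  measurable_fun setT (fun x : d.-tuple (measurableTypeR R) => \sum_(i < d) tnth x i ^+ 2).
Proof.
apply: measurable_sum => i; apply: measurable_funX; exact: measurable_tnth.
Qed.

Definition unit_ball (R : realType) (d : nat) : set (d.-tuple (measurableTypeR R)) :=
  [set x : d.-tuple R | enorm x <= 1].

Lemma measurable_unit_ball (R : realType) (d : nat) : measurable (@unit_ball R d).
Proof.
rewrite (_ : @unit_ball R d = (fun x : d.-tuple (measurableTypeR R) =>
    \sum_(i < d) tnth x i ^+ 2) @^-1` `]-oo, 1]%classic).
  rewrite -[X in measurable X]setTI; exact: measurable_sum_sqr.
by apply/seteqP; split => x; rewrite /unit_ball/= enorm_le1 in_itv.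
Qed.

Lemma lebesgue_tuple_ball_lty (R : realType) (d : nat) :
  (lebesgue_tuple R d (@unit_ball R d) < +oo)%E.
Proof.
apply: (@le_lt_trans _ _ (lebesgue_tuple R d
    [set y | forall i, `|tnth y i - tnth (origin R d) i| <= 1])).
  apply: le_measure; rewrite ?inE; [exact: measurable_unit_ball|exact: measurable_cube|].
  move=> y yB i; rewrite tnth_mktuple subr0; exact: le_trans (tnth_le_enorm _ _) yB.
by rewrite lebesgue_tuple_cube// ltry.
Qed.

Arguments unit_ball : clear implicits.

(** * Integrability of the weight for [mu = 0] *)

Lemma measurable_inv_sqrt_sum_sqr (R : realType) (d : nat) :
  measurable_fun setT (fun x : d.-tuple (measurableTypeR R) =>
    (Num.sqrt (1 - \sum_(i < d) tnth x i ^+ 2))^-1).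
Proof.
under eq_fun do rewrite -powR_inv1 ?sqrtr_ge0//.
apply: (measurableT_comp (measurable_powR _)).
apply: (measurableT_comp (continuous_measurable_fun (@sqrt_continuous R))).
by apply: measurable_funB => //; exact: measurable_sum_sqr.
Qed.

(* Junk values make the integrand vanish outside the open ball:
   [Num.sqrt] is 0 on negative numbers, and [0^-1 = 0]. *)
Lemma integral_inv_sqrt_sum_sqr_lty (R : realType) (d : nat) :
  (\int[lebesgue_tuple R d.+1]_x
    ((Num.sqrt (1 - \sum_(i < d.+1) tnth x i ^+ 2))^-1)%:E < +oo)%E.
Proof.
have mf := @measurable_inv_sqrt_sum_sqr R d.+1.
rewrite ge0_integral_lebesgue_tuple; last 2 first.
- exact/measurable_EFinP.
- by move=> x; rewrite lee_fin invr_ge0 sqrtr_ge0.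
(* The inner integral is at most [pi] on the cube [Q] and vanishes off it, so the outer one is at
   most [pi] times the finite volume of [Q]. *)
pose Q : set (d.-tuple (measurableTypeR R)) :=
  [set y | forall i, `|tnth y i - tnth (origin R d) i| <= 1].
have mQ : measurable Q by exact: measurable_cube.
apply: (@le_lt_trans _ _ (\int[lebesgue_tuple R d]_y (pi%:E * (\1_Q y)%:E))%E).
  apply: ge0_le_integral => //.
  - by move=> y _; apply: integral_ge0 => x _; rewrite lee_fin invr_ge0 sqrtr_ge0.
  - apply: (measurable_fun_fubini_tonelli_G (m1 := @lebesgue_measure R)
      ((fun x : d.+1.-tuple (measurableTypeR R) =>
        ((Num.sqrt (1 - \sum_(i < d.+1) tnth x i ^+ 2))^-1)%:E) \o @tuple_of_pair R d)).
    + apply: measurableT_comp; [exact/measurable_EFinP|exact: measurable_tuple_of_pair].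
    + by move=> z; rewrite /= lee_fin invr_ge0 sqrtr_ge0.
  - by apply: measurable_funeM; exact/measurable_EFinP.
  move=> y _; set s := \sum_(i < d) tnth y i ^+ 2.
  have sE x : \sum_(i < d.+1) tnth (tuple_of_pair (x, y)) i ^+ 2 = x ^+ 2 + s.
    rewrite big_ord_recl /= tnth0; congr (_ + _).
    by apply: eq_bigr => i _; rewrite tnthS.
  have [s1|s1] := leP 1 s.
    rewrite integral0_eq ?mule_ge0 ?lee_fin ?pi_ge0// => x _.
    rewrite sE ler0_sqrtr ?invr0//.
    by rewrite subr_le0 (le_trans s1)// lerDr sqr_ge0.
  pose r := Num.sqrt (1 - s).
  have r0 : 0 < r by rewrite sqrtr_gt0 subr_gt0.
  have -> : \1_Q y = 1 :> R.
    rewrite indicE mem_set// => i; rewrite tnth_mktuple subr0.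
    by apply: (le_trans (tnth_le_enorm _ _)); rewrite enorm_le1 ltW.
  rewrite mule1; apply: le_trans (integral_arcsine_le r0).
  (* Outside [(-r, r)] the radicand is nonpositive and the integrand is 0, so integrating over the
     whole line or over the interval is the same. *)
  rewrite [leRHS]integral_mkcond (eq_integral (fun x : measurableTypeR R =>
    ((Num.sqrt (1 - \sum_(i < d.+1) tnth (tuple_of_pair (x, y)) i ^+ 2))^-1)%:E))// => x _.
  rewrite patchE sE; have -> : 1 - (x ^+ 2 + s) = r ^+ 2 - x ^+ 2.
    by rewrite sqr_sqrtr ?subr_ge0 ?ltW//; ring.
  case: ifPn => //; rewrite notin_setE/= in_itv/= -ltr_norml => /negP; rewrite -leNgt => rx.
  rewrite ler0_sqrtr ?invr0// subr_le0 -[leRHS]real_normK ?num_real//.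
  by rewrite ler_sqr ?nnegrE// ltW.
rewrite ge0_integralZl_EFin//.
- rewrite integral_indic// setIT lte_mul_pinfty ?lee_fin ?pi_ge0//.
  apply: (@le_lt_trans _ _ ((2 * 1) ^+ d)%:E); last by rewrite ltry.
  by rewrite -(lebesgue_tuple_cube (origin R d) ler01).
- exact/measurable_EFinP.
- exact: pi_ge0.
Qed.

(** * Powers of [1 - |x| ^ 2] and the moment functional of the ball *)

Definition sphere_poly (R : realType) (d : nat) : mpoly d R :=
  1 - \sum_(i < d) mpolyX R (mnm1 i) ^+ 2.

Lemma peval_sphere_polyX (R : realType) (d n : nat) (x : d.-tuple R) :
  peval (sphere_poly R d ^+ n) x = (1 - enorm x ^+ 2) ^+ n.
Proof.
rewrite /peval; elim: n => [|n IH]; first by rewrite !expr0 meval1.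
rewrite exprS mevalM IH [RHS]exprS; congr (_ * _).
rewrite /sphere_poly mevalB meval1 (raddf_sum (meval (tnth x))) enorm_sqr; congr (1 - _).
by apply: eq_bigr => i _; rewrite [in LHS]expr2 [LHS]mevalM mevalXU expr2.
Qed.

Lemma degree_le_sphere_polyX (R : realType) (d n : nat) :
  degree_le n.*2 (sphere_poly R d ^+ n).
Proof.
(* The measure is one plus the degree, hence 3 for a quadratic polynomial. *)
have size_poly : (mmeasure mdeg (sphere_poly R d) <= 3)%N.
  rewrite (leq_trans (mmeasureD_le _ _ _))// geq_max mmeasureN mmeasure1/=.
  rewrite (leq_trans (mmeasure_sum _ _ _ _))//; apply/bigmax_leqP => i _.
  by rewrite mpolyXn mmeasureX /= mdegMn mdeg1.
elim: n => [|n IH]; first by rewrite expr0 /degree_le mmeasure1.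
rewrite exprS /degree_le.
have [->|p0] := eqVneq (sphere_poly R d) 0; first by rewrite mul0r mmeasure0.
have [->|q0] := eqVneq (sphere_poly R d ^+ n) 0; first by rewrite mulr0 mmeasure0.
move: size_poly IH; rewrite /degree_le msizeM//.
move: (mmeasure _ _) (mmeasure _ _) => a b; lia.
Qed.

Section ball_moment_properties.
Variables (R : realType) (d : nat) (mu : R).
Hypothesis mu_ge0 : 0 <= mu.

Local Notation leb := (lebesgue_tuple R d.+1).
Local Notation B := (unit_ball R d.+1).

Let weight (x : d.+1.-tuple (measurableTypeR R)) : R :=
  (1 - enorm x ^+ 2) `^ (mu - 1 / 2).

Let measurable_weight : measurable_fun setT weight.
Proof.
apply: (measurableT_comp (measurable_powR _)).
under eq_fun do rewrite enorm_sqr.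
by apply: measurable_funB => //; exact: measurable_sum_sqr.
Qed.

(** The exponent is at least [- 1 / 2] and the base is at most 1, so inside the ball the inverse
    square root alone dominates. *)
Let weight_le (x : d.+1.-tuple R) : B x ->
  weight x <= 1 + (Num.sqrt (1 - \sum_(i < d.+1) tnth x i ^+ 2))^-1.
Proof.
rewrite /unit_ball/= /weight enorm_sqr enorm_le1.
have : 0 <= \sum_(i < d.+1) tnth x i ^+ 2 by apply: sumr_ge0 => i _; exact: sqr_ge0.
set s := \sum_i _ => s0; rewrite le_eqVlt => /predU1P[->|s1].
  (* On the sphere the inverse root takes the junk value 0, while for [mu = 1 / 2] the weight is the
     zeroth power of 0, which is 1; the summand 1 in the bound covers this. *)
  rewrite subrr sqrtr0 invr0 addr0.
  have [->|h] := eqVneq (mu - 1 / 2) 0; first by rewrite powRr0.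
  by rewrite powR0.
have s1' : 0 < 1 - s by rewrite subr_gt0.
rewrite -(powR12_sqrt (ltW s1')) -powRN; apply: ler_wpDl => //.
apply: ger_powR; last by rewrite div1r -subr_ge0 opprK subrK.
by rewrite s1' /= gerBl.
Qed.

Let integrable_weight : leb.-integrable B (EFin \o weight).
Proof.
apply: (le_integrable (mu := leb) (@measurable_unit_ball R d.+1)
  (g := fun x => (1%:E + ((Num.sqrt (1 - \sum_(i < d.+1) tnth x i ^+ 2))^-1)%:E)%E)).
- by apply: measurable_funTS; exact/measurable_EFinP.
- move=> x /weight_le wx; rewrite /= lee_fin ger0_norm ?powR_ge0//.
  exact: le_trans wx (ler_norm _).
- apply: integrableD => //; first exact: measurable_unit_ball.
    apply/integrableP; split=> //; rewrite integral_cst//= ?normr1 ?mul1e.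
      exact: lebesgue_tuple_ball_lty.
    exact: measurable_unit_ball.
  apply: (integrableS measurableT) => //; first exact: measurable_unit_ball.
  apply/integrableP; split.
    by apply/measurable_EFinP; exact: measurable_inv_sqrt_sum_sqr.
  apply: le_lt_trans (@integral_inv_sqrt_sum_sqr_lty R d).
  rewrite le_eqVlt; apply/orP; left; apply/eqP; apply: eq_integral => x _.
  by rewrite gee0_abs// lee_fin invr_ge0 sqrtr_ge0.
Qed.

Let peval_bounded (p : mpoly d.+1 R) :
  exists2 M : R, 0 <= M & forall x, B x -> `|peval p x| <= M.
Proof.
exists (\sum_(m <- msupp p) `|mcoeff m p|); first by apply: sumr_ge0.
move=> x Bx; rewrite /peval mevalE (le_trans (ler_norm_sum _ _ _))//.
apply: ler_sum => m _; rewrite normrM ler_piMr// normr_prod.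
apply: prodr_ile1 => i _; rewrite normr_ge0 normrX exprn_ile1//.
exact: le_trans (tnth_le_enorm _ _) Bx.
Qed.

Let integrable_peval_weight (p : mpoly d.+1 R) :
  leb.-integrable B (fun x => (peval p x * weight x)%:E).
Proof.
have [M M0 pM] := peval_bounded p.
apply: (le_integrable (mu := leb) (@measurable_unit_ball R d.+1)
  (g := fun x => (M%:E * (weight x)%:E)%E)).
- apply: measurable_funTS; apply/measurable_EFinP; apply: measurable_funM => //.
  exact: measurable_peval.
- move=> x Bx; rewrite -EFinM !abse_EFin lee_fin !normrM ler_wpM2r//.
  by rewrite (ger0_norm M0) pM.
- by apply: integrableZl => //; exact: measurable_unit_ball.
Qed.

(** Additivity of the real-valued integral requires integrability, and this is where [mu_ge0]
    enters. *)
Lemma ball_moment_linear a (p q : mpoly d.+1 R) :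
  ball_moment mu (a *: p + q) = a * ball_moment mu p + ball_moment mu q.
Proof.
rewrite /ball_moment mulrCA -mulrDr; congr (_ * _).
have mB := @measurable_unit_ball R d.+1.
rewrite -RintegralZl//; last exact: (integrable_peval_weight p).
rewrite -RintegralD//.
- apply: eq_Rintegral => x _; rewrite /peval mevalD mevalZ.
  by rewrite mulrDl mulrA.
- have := integrableZl mB a (integrable_peval_weight p).
  by apply: eq_integrable.
- exact: (integrable_peval_weight q).
Qed.

Lemma ball_constant_gt0 : 0 < ball_constant d.+1 mu.
Proof.
rewrite /ball_constant divr_gt0 ?mulr_gt0 ?powR_gt0 ?pi_gt0 ?euler_gamma_gt0//.
  rewrite mulrDl addrA lerDr addr_ge0// divr_ge0//.
by rewrite lerDr.
Qed.

(** A nonzero polynomial is nonzero at some point near the origin, hence on a small cube around it.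
    Inside the open ball the weight is positive as well, so the integrand is positive on a set of
    positive measure. *)
Lemma ball_moment_gt0 (p : mpoly d.+1 R) : p != 0 -> 0 < ball_moment mu (p * p).
Proof.
move=> p0; rewrite mulr_gt0 ?ball_constant_gt0//.
(* The center and the offset contribute at most [delta] each, so the coordinates on [Q] are at most
   [1 / (d + 2)] in absolute value and their [d + 1] squares add up to less than 1. *)
pose delta : R := (2 * d.+2%:R)^-1.
have delta0 : 0 < delta by rewrite invr_gt0 mulr_gt0.
have [x xd px] := peval_neq0_near0 p0 delta0.
have [|e e0 pe] := @peval_near R d.+1 p x `|peval p x|; first by rewrite normr_gt0.
pose m := Num.min e delta.
have m0 : 0 < m by rewrite lt_min e0 delta0.
pose Q : set (d.+1.-tuple (measurableTypeR R)) :=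
  [set y | forall i, `|tnth y i - tnth x i| <= m].
have Q_small y : Q y -> \sum_(i < d.+1) tnth y i ^+ 2 < 1.
  move=> Qy; have yi i : `|tnth y i| <= d.+2%:R^-1.
    rewrite -(subrK (tnth x i) (tnth y i)) (le_trans (ler_normD _ _))//.
    have : `|tnth y i - tnth x i| <= delta by rewrite (le_trans (Qy i))// ge_min lexx orbT.
    have := xd i; have -> : d.+2%:R^-1 = delta + delta.
      by rewrite /delta; field.
    lra.
  apply: (@le_lt_trans _ _ (\sum_(i < d.+1) d.+2%:R^-1)).
    apply: ler_sum => i _; rewrite -[leLHS]real_normK ?num_real//.
    apply: le_trans (yi i); rewrite expr2 ler_piMr// (le_trans (yi i))//.
    by rewrite invf_le1// ler1n.
  by rewrite sumr_const card_ord -[ltLHS]mulr_natl ltr_pdivrMr// mul1r ltr_nat.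
have mB := @measurable_unit_ball R d.+1.
have /integrableP[mf fin] := integrable_peval_weight (p * p).
have f0 y : B y -> (0 <= (peval (p * p) y * weight y)%:E)%E.
  by move=> _; rewrite lee_fin mulr_ge0 ?powR_ge0// /peval mevalM -expr2 sqr_ge0.
apply: fine_gt0; apply/andP; split.
  apply: (@ge0_integral_gt0 _ _ _ leb B Q (fun y => (peval (p * p) y * weight y)%:E)) => //.
  - exact: measurable_cube.
  - by move=> y /Q_small y1; rewrite /unit_ball/= enorm_le1 ltW.
  - move=> y Qy; rewrite lte_fin mulr_gt0//.
      rewrite /peval mevalM -expr2 exprn_even_gt0//=.
      have me : m <= e by rewrite ge_min lexx.
      have := pe y (fun i => le_trans (Qy i) me).
      by apply: contraTN => /eqP; rewrite /peval => ->; rewrite sub0r normrN ltxx.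
    by rewrite /weight enorm_sqr powR_gt0// subr_gt0 Q_small.
  - apply: (@lt_le_trans _ _ ((2 * m) ^+ d.+1)%:E).
      by rewrite lte_fin exprn_gt0// mulr_gt0.
    by rewrite -(lebesgue_tuple_cube x (ltW m0)).
apply: le_lt_trans fin.
rewrite le_eqVlt; apply/orP; left; apply/eqP; apply: eq_integral => y; rewrite inE => /f0 y0.
by rewrite gee0_abs.
Qed.

(** Dominated convergence: on the ball [1 - |x| ^ 2] lies between 0 and 1, so [weight] is a
    majorant, and the powers tend to 0 except at the origin. *)
Lemma ball_moment_sphere_poly_cvg0 :
  ball_moment mu (sphere_poly R d.+1 ^+ n * sphere_poly R d.+1 ^+ n) @[n --> \oo] --> 0.
Proof.
rewrite /ball_moment -[X in _ --> X](mulr0 (ball_constant d.+1 mu)).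
apply: cvgM; first exact: cvg_cst.
have mB := @measurable_unit_ball R d.+1.
pose f n x := (peval (sphere_poly R d.+1 ^+ n * sphere_poly R d.+1 ^+ n) x * weight x)%:E.
have fE n x : f n x = ((1 - enorm x ^+ 2) ^+ n.*2 * weight x)%:E.
  by rewrite /f -exprD addnn peval_sphere_polyX.
have B01 x : B x -> 0 <= 1 - enorm x ^+ 2 <= 1.
  rewrite /unit_ball/= => x1; rewrite subr_ge0 gerBl sqr_ge0 andbT.
  by rewrite expr_le1// sqrtr_ge0.
have [|||||_ _] := @dominated_convergence _ _ R leb B mB f (cst 0%E) (EFin \o weight).
- move=> n; set p := sphere_poly R d.+1 ^+ n.
  by have /integrableP[] := integrable_peval_weight (p * p).
- exact: measurable_cst.
(* The exceptional set is the origin, written as a cube of side 0; it is null because the dimension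
   is positive. *)
- exists [set y | forall i, `|tnth y i - tnth (origin R d.+1) i| <= 0]; split.
  + exact: measurable_cube.
  + have := lebesgue_tuple_cube (origin R d.+1) (lexx (0 : R)).
    by rewrite mulr0 expr0n.
  + move=> x /= h i; rewrite leNgt; apply/negP; rewrite tnth_mktuple subr0 => xi.
    apply: h => Bx; have /andP[b0 b1] := B01 x Bx.
    have ex : 0 < enorm x ^+ 2 by rewrite exprn_gt0// (lt_le_trans xi)// tnth_le_enorm.
    rewrite (_ : f ^~ x = EFin \o
        (fun n => (1 - enorm x ^+ 2) ^+ n * ((1 - enorm x ^+ 2) ^+ n * weight x))).
      apply: cvg_EFin; first exact: nearW.
      have Fcvg : (1 - enorm x ^+ 2) ^+ n @[n --> \oo] --> 0.
        by apply: cvg_expr; rewrite ger0_norm// gtrBl.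
      rewrite -[X in _ --> X](mul0r (0 * weight x)); apply: cvgM => //.
      by apply: cvgM => //; exact: cvg_cst.
    by apply/funext => n /=; rewrite fE -addnn exprD mulrA.
- exact: integrable_weight.
- apply: aeW => x n Bx; have /andP[b0 b1] := B01 x Bx.
  rewrite fE abse_EFin lee_fin normrM !ger0_norm ?powR_ge0 ?exprn_ge0//.
  by rewrite ler_piMl ?powR_ge0// exprn_ile1.
rewrite integral0 => /fine_cvg; exact.
Qed.

End ball_moment_properties.

(** * The limit of the kernel at the origin *)

Unset Implicit Arguments.

Theorem theorem5p5 (R : realType) (d : nat) (mu lambda : R)
    (hd : (2 <= d)%N) (hmu : 0 <= mu) (hlambda : 0 < lambda) :
  let v := add_point_mass (@ball_moment R d mu) lambda (origin R d) in
  reproducing_kernel v n (origin R d) (origin R d) @[n --> \oo] --> 1 / lambda.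
Proof.
move=> v; case: d hd @v => [//|d'] _ v.
have v_lin a p q : v (a *: p + q) = a * v p + v q.
  rewrite /v /add_point_mass (ball_moment_linear hmu) /peval mevalD mevalZ.
  by ring.
have sqr0 p : peval (p * p) (origin R d'.+1) = peval p (origin R d'.+1) ^+ 2.
  by rewrite /peval mevalM expr2.
have v_ge p : lambda * peval p (origin R d'.+1) ^+ 2 <= v (p * p).
  rewrite /v /add_point_mass sqr0 lerDr.
  have [->|/(ball_moment_gt0 hmu)/ltW//] := eqVneq p 0.
  have := ball_moment_linear hmu (-1) (0 : mpoly d'.+1 R) 0.
  by rewrite scaleN1r addNr mulN1r addNr mulr0 => ->.
have v_pos p : p != 0 -> 0 < v (p * p).
  move=> /(ball_moment_gt0 hmu) p0; rewrite ltr_pwDl// sqr0.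
  by rewrite mulr_ge0 ?sqr_ge0// ltW.
have K_le n := reproducing_kernel_le v_lin v_pos n hlambda v_ge.
apply/cvgrPdist_le => e e0.
have := @ball_moment_sphere_poly_cvg0 R d' mu hmu => /cvgrPdist_le.
(* With [a = u (f ^ 2)], the bounds [1 <= (a + lambda) * K] and [K <= 1 / lambda] give [1 / lambda -
   K <= a * K / lambda <= a / lambda ^+ 2]; the tolerance makes this at most [e]. *)
move=> /(_ (e * lambda ^+ 2)) []; first by rewrite mulr_gt0// exprn_gt0.
move=> k _ /(_ k (leqnn _)); rewrite sub0r normrN => /(le_trans (ler_norm _)).
set f := sphere_poly R d'.+1 ^+ k; set a := ball_moment mu _ => ae.
(* The single test polynomial [f], of degree at most [2 * k], serves all [n >= 2 * k]. *)
exists k.*2 => //= n kn.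
have f0 : peval f (origin R d'.+1) = 1.
  rewrite peval_sphere_polyX enorm_sqr big1 ?subr0 ?expr1n// => i _.
  by rewrite tnth_mktuple expr0n.
have fn : degree_le n f by rewrite /degree_le (leq_trans (degree_le_sphere_polyX _ _ _)).
have := reproducing_kernel_ge v_lin v_pos fn f0; have := K_le n.
have -> : v (f * f) = a + lambda by rewrite /v /add_point_mass sqr0 f0 expr1n mulr1.
set K := reproducing_kernel _ _ _ _ => K1 K2.
have a0 : 0 <= a.
  have := v_ge f; rewrite f0 expr1n mulr1 /v /add_point_mass sqr0 f0 expr1n mulr1.
  by rewrite lerDr.
rewrite ger0_norm ?subr_ge0// lerBlDl -(ler_pM2r hlambda) div1r mulVf ?gt_eqF//.
have : a * K <= e * lambda.
  apply: (@le_trans _ _ (a * (1 / lambda))); first by rewrite ler_wpM2l.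
  by rewrite mulrA mulr1 ler_pdivrMr// -mulrA -expr2.
by nra.
Qed.
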